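(* Let $X$ be a complete locally compact geodesic metric space satisfying the $\mathrm{LEG}$ condition and the $\mathrm{LRB}$ condition. Then every bounded self-contracted curve $\gamma:I\to X$, where $I\subset\mathbb{R}$ is an interval, is rectifiable.
   Context: A metric space is geodesic if every two points $x,y$ are joined by a continuous curve of length $d(x,y)$. $B_r(x)$ denotes the open ball. $\mathrm{LEG}$ (locally extendable geodesics) condition: a point $x$ of a complete geodesic metric space $X$ satisfies $\mathrm{LEG}$ with parameter $\epsilon>0$ if for every unit speed minimizing geodesic $\gamma:[0,T]\to B_\epsilon(x)$ there exists a unit speed minimizing geodesic $\widetilde\gamma:[0,T+\epsilon]\to X$ with $\widetilde\gamma(t)=\gamma(t)$ for all $t\in[0,T]$. $X$ satisfies $\mathrm{LEG}$ if every $x\in X$ satisfies $\mathrm{LEG}$ with some $\epsilon(x)>0$. $\mathrm{LRB}$ (locally rough Busemann) condition: a point $x$ of a complete geodesic metric space $X$ satisfies $\mathrm{LRB}$ with parameters $H,K>0$ if for every pair of unit speed minimizing geodesics $\gamma_1:[0,L_1]\to B_H(x)$, $\gamma_2:[0,L_2]\to B_H(x)$ with $\gamma_1(0)=\gamma_2(0)$ we have $d(\gamma_1(tL_1),\gamma_2(tL_2))\le K\,t\,d(\gamma_1(L_1),\gamma_2(L_2))$ for every $t\in[0,1]$. $X$ satisfies $\mathrm{LRB}$ if every $x\in X$ satisfies $\mathrm{LRB}$ with some $H(x),K(x)>0$. A curve is any map $\gamma:I\to X$ from an interval $I\subset\mathbb{R}$, not necessarily continuous. It is self-contracted if $d(\gamma(t_2),\gamma(t_3))\le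 d(\gamma(t_1),\gamma(t_3))$ for all $t_1\le t_2\le t_3$ in $I$. It is bounded if its image is bounded. It is rectifiable if $\sup\{\sum_{i=1}^{k-1}d(\gamma(t_i),\gamma(t_{i+1})) : k\in\mathbb{N},\ t_1<\dots<t_k,\ t_i\in I\}<\infty$. *)

(* Defs.v *)
From HB Require Import structures.
From mathcomp Require Import all_boot all_order all_algebra.
From mathcomp Require Import all_classical all_reals all_analysis.

Set Implicit Arguments.
Unset Strict Implicit.
Unset Printing Implicit Defensive.

Import Order.TTheory GRing.Theory Num.Theory.
Import numFieldNormedType.Exports.

Local Open Scope classical_set_scope.
Local Open Scope ring_scope.

(* A curve on I : set R is a total function R -> X of which only the
   restriction to I is ever used. *)

Section MetricSpaces.
Context {R : realType} (X : metricType R).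
Implicit Types (g : R -> X) (I : set R) (x y : X).

(* The axiom of completeType, restated because completeType also requires a
   distinguished point. *)
Definition complete_space : Prop :=
  forall F : set_system X, ProperFilter F -> cauchy F -> exists x : X, F --> x.

Definition metric_bounded (A : set X) : Prop :=
  exists M : R, forall x y, A x -> A y -> mdist x y <= M.

Definition chain_length g (s : seq R) : R :=
  \sum_(0 <= i < (size s).-1) mdist (g s`_i) (g s`_i.+1).

Definition curve_length I g : \bar R :=
  ereal_sup [set (chain_length g s)%:E
            | s in [set s : seq R | sorted <%R s /\ [set` s] `<=` I]].

Definition rectifiable I g : Prop := (curve_length I g < +oo)%E.

Definition geodesic_space : Prop :=
  forall x y, exists (a b : R) (g : R -> X),
    [/\ a <= b, {within `[a, b], continuous g}, g a = x, g b = y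
      & curve_length `[a, b] g = (mdist x y)%:E].

(* Only nondegenerate domains [0, T] count as geodesics; in LEG and LRB below
   this makes the hypotheses weakest. *)
Definition unit_speed_minimizing (T : R) g : Prop :=
  0 < T /\ forall s t : R, s \in `[0, T] -> t \in `[0, T] ->
    mdist (g s) (g t) = `|s - t|.

Definition LEG_at x (e : R) : Prop :=
  forall (T : R) g, unit_speed_minimizing T g ->
    (forall t : R, t \in `[0, T] -> ball x e (g t)) ->
  exists2 h : R -> X, unit_speed_minimizing (T + e) h &
    forall t : R, t \in `[0, T] -> h t = g t.

Definition LEG : Prop := forall x, exists2 e : R, 0 < e & LEG_at x e.

Definition LRB_at x (H K : R) : Prop :=
  forall (L1 L2 : R) (g1 g2 : R -> X),
    unit_speed_minimizing L1 g1 -> unit_speed_minimizing L2 g2 ->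
    (forall t : R, t \in `[0, L1] -> ball x H (g1 t)) ->
    (forall t : R, t \in `[0, L2] -> ball x H (g2 t)) ->
    g1 0 = g2 0 ->
  forall t : R, t \in `[0, 1] ->
    mdist (g1 (t * L1)) (g2 (t * L2)) <= K * t * mdist (g1 L1) (g2 L2).

Definition LRB : Prop :=
  forall x, exists H K : R, [/\ 0 < H, 0 < K & LRB_at x H K].

Definition self_contracted I g : Prop :=
  forall t1 t2 t3 : R, I t1 -> I t2 -> I t3 -> t1 <= t2 -> t2 <= t3 ->
    mdist (g t2) (g t3) <= mdist (g t1) (g t3).

End MetricSpaces.

(* Main.v *)
(** Near a point of X, LEG extends every short geodesic to a fixed length and
    LRB pulls the endpoints of two such extensions back towards their common
    origin. A finite net for the endpoints therefore colours directions with M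
    colours such that, if y and z have the same colour seen from o and
    d(o,y) <= d(o,z), then y lies almost on a geodesic from o to z.

    Let p_0, p_1, ... be a self-contracted sequence near that point. The goal
    is a bound for the length of a segment [i, j] of indices, given a set T of
    later targets that have distinct colours from every p_o with o in [i, j];
    it is proved by downward induction on #T, the case #T = M + 1 being
    impossible. Read the segment backwards from v and stop at the last o for
    which the length of [o, v] exceeds a large multiple of d(p_o, p_v). If no b
    in [o, v] were such that p_v has from p_b the colour of a target, v could
    be added to T, and the induction hypothesis would bound the length of
    [o, v]. So there is such a b; take the first one. The induction hypothesis
    for [o, b - 1] shows that [b, v] carries half of the length of [o, v],
    and by the choice of o that length is comparable to d(p_b, p_v). Since p_v
    has the colour of a target x, moving from p_b to p_v either approaches p_x
    at a definite rate or overshoots p_x. As distances to p_x do not increase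
    along the sequence, the sum of d(p_b, p_v) over disjoint such intervals is
    at most a constant times the diameter.

    Globally, bounded sets are totally bounded (Hopf-Rinow), so finitely many
    good balls with a Lebesgue number suffice: small jumps stay inside one ball,
    and the endpoints of large jumps are separated, so there are few of them. *)
Require Import Defs.
From HB Require Import structures.
From mathcomp Require Import all_boot all_order all_algebra.
From mathcomp Require Import all_classical all_reals all_analysis.
From mathcomp Require Import zify ring lra.
Import Order.TTheory GRing.Theory Num.Theory.
Import numFieldNormedType.Exports.
Local Open Scope classical_set_scope.
Local Open Scope ring_scope.

(** * Self-contracted sequences *)

Section SelfContractedSequences.
Context {R : realType} {X : metricType R}.
Implicit Types (p : nat -> X) (s : seq (nat * nat)) (i j o b v x : nat).

Definition self_contracted_seq p : Prop :=
  forall i j k, (i <= j)%N -> (j <= k)%N -> mdist (p j) (p k) <= mdist (p i) (p k).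

Definition seq_length p i j : R := \sum_(i <= l < j) mdist (p l) (p l.+1).

Lemma seq_lengthnn p i : seq_length p i i = 0.
Proof. by rewrite /seq_length big_geq. Qed.

Lemma seq_length_cat {p} j i k : (i <= j)%N -> (j <= k)%N ->
  seq_length p i k = seq_length p i j + seq_length p j k.
Proof. by move=> ij jk; rewrite /seq_length (big_cat_nat ij jk). Qed.

Lemma seq_lengthS p i : seq_length p i i.+1 = mdist (p i) (p i.+1).
Proof. by rewrite /seq_length big_nat1. Qed.

(** * Non-overlapping intervals of indices and the sum of their chords *)

Fixpoint blocks i s j : bool :=
  if s is (b, v) :: s' then [&& (i <= b)%N, (b <= v)%N & blocks v s' j]
  else (i <= j)%N.

Lemma blocks_leq i s j : blocks i s j -> (i <= j)%N.
Proof.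
elim: s i => [//|[b v] s IHs] i /= /and3P[ib bv /IHs vj].
exact: leq_trans (leq_trans ib bv) vj.
Qed.

Lemma blocks_widen i i' s j : (i' <= i)%N -> blocks i s j -> blocks i' s j.
Proof.
case: s => [|[b v] s] /= ii'; first exact: leq_trans.
by move=> /and3P[ib -> ->]; rewrite (leq_trans ii' ib).
Qed.

Lemma blocks_filter (P : pred (nat * nat)) i s j :
  blocks i s j -> blocks i [seq e <- s | P e] j.
Proof.
elim: s i => [//|[b v] s IHs] i /= /and3P[ib bv /IHs bs].
case: ifP => _ /=; first by rewrite ib bv.
exact: blocks_widen (leq_trans ib bv) bs.
Qed.

Lemma blocks_rcons i s j b v :
  blocks i s j -> (j <= b)%N -> (b <= v)%N -> blocks i (rcons s (b, v)) v.
Proof.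
elim: s i => [|[b' v'] s IHs] i /=.
  by move=> ij jb bv; rewrite (leq_trans ij jb) bv leqnn.
by move=> /and3P[-> -> bs] jb bv; exact: IHs.
Qed.

Definition sum_dist p s : R := \sum_(e <- s) mdist (p e.1) (p e.2).

Lemma sum_dist_rcons p s b v :
  sum_dist p (rcons s (b, v)) = sum_dist p s + mdist (p b) (p v).
Proof. by rewrite /sum_dist -cats1 big_cat big_seq1. Qed.

Definition progress p x b v : bool :=
  mdist (p b) (p v) <= 8 * (mdist (p b) (p x) - mdist (p v) (p x)).

(* The factor [3 / 5 = (1 + 1 / 8) / (2 - 1 / 8)] comes from combining the
   failure of [progress] with [direction_map]. *)
Definition overshoot p x b v : bool :=
  mdist (p b) (p x) < 3 / 5 * mdist (p b) (p v).

Definition bad p (T : seq nat) b v : bool :=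
  has (fun x => progress p x b v || overshoot p x b v) T.

(** Telescoping: each interval uses up at least an eighth of its chord from the distance to [p x],
    and this distance cannot grow between intervals. *)
Lemma sum_progress p x i s j : self_contracted_seq p ->
  (j <= x)%N -> blocks i s j -> all (fun e => progress p x e.1 e.2) s ->
  sum_dist p s <= 8 * (mdist (p i) (p x) - mdist (p j) (p x)).
Proof.
move=> sc jx; rewrite /sum_dist; elim: s i => [|[b v] s IHs] i /=.
  by move=> ij _; rewrite big_nil; have := sc i j x ij jx; lra.
move=> /and3P[ib bv bs] /andP[prg /(IHs _ bs)]; rewrite big_cons /=.
have vj := blocks_leq _ _ _ bs.
have := sc i b x ib (leq_trans bv (leq_trans vj jx)).
by move: prg; rewrite /progress; lra.
Qed.

Section Directions.
Variables (B : set X) (M : nat) (dir : X -> X -> 'I_M).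

(* [dir o y] is a colour for the direction of [y] seen from [o]: if [y] and [z]
   have the same colour, the nearer one lies almost on a shortest curve from
   [o] to the farther one. *)
Definition direction_map : Prop := forall o y z : X, B o -> B y -> B z ->
  dir o y = dir o z -> mdist o y <= mdist o z ->
  mdist y z <= mdist o z - 7 / 8 * mdist o y.

Hypothesis dirP : direction_map.
Variable p : nat -> X.
Hypotheses (sc : self_contracted_seq p) (pB : forall i, B (p i)).

(** With equal colours, [direction_map] applies to whichever of [p v] and [p x] is nearer to [p b]:
    the first case forces progress, the second progress or overshoot. *)
Lemma not_bad_dir x b v : (b <= v)%N -> (v <= x)%N ->
  ~~ progress p x b v -> ~~ overshoot p x b v ->
  dir (p b) (p v) != dir (p b) (p x).
Proof.
move=> bv vx; rewrite /progress /overshoot -ltNge -leNgt => nprg nov; apply/eqP => eqd.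
have [le|lt] := leP (mdist (p b) (p v)) (mdist (p b) (p x)).
  by have := dirP _ _ _ (pB b) (pB v) (pB x) eqd le;
    have := mdist_ge0 (p b) (p v); move: nprg; lra.
have := dirP _ _ _ (pB b) (pB x) (pB v) (esym eqd) (ltW lt).
by rewrite (metric_sym (p x)); move: nprg nov; lra.
Qed.

(** Seen from [p x], [p v] and the preceding endpoint [p v0] share a colour, so d(v0,v) is at most
    the drop in distance to [p x] plus d(v,x)/8. That error is absorbed because d(v,x) <= d(b,x) <
    3/5 d(b,v) and d(b,v) <= d(v0,v). *)
Lemma sum_overshoot x a v0 i s j : (v0 <= i)%N -> (j <= x)%N ->
  dir (p x) (p v0) = a -> blocks i s j ->
  all (fun e => overshoot p x e.1 e.2 && (dir (p x) (p e.2) == a)) s ->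
  sum_dist p s <= 2 * (mdist (p v0) (p x) - mdist (p j) (p x)).
Proof.
move=> + jx; rewrite /sum_dist; elim: s v0 i => [|[b v] s IHs] v0 i /= v0i da.
  by move=> ij _; rewrite big_nil; have := sc v0 j x (leq_trans v0i ij) jx; lra.
move=> /and3P[ib bv bs] /andP[/andP[ov /eqP dv] /(IHs v v (leqnn v) dv bs)].
rewrite big_cons /=.
have vx := leq_trans (blocks_leq _ _ _ bs) jx.
have bvx : mdist (p v) (p x) <= mdist (p b) (p x) := sc b v x bv vx.
have v0b := leq_trans v0i ib.
have vv0 : mdist (p v) (p x) <= mdist (p v0) (p x).
  exact: sc (leq_trans v0b bv) vx.
have := dirP (p x) (p v) (p v0) (pB x) (pB v) (pB v0).
rewrite dv da (metric_sym (p x) (p v)) (metric_sym (p x) (p v0)) (metric_sym (p v) (p v0)) => /(_ erefl vv0).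
have := sc v0 b v v0b bv; move: ov; rewrite /overshoot.
by have := mdist_ge0 (p v) (p x); lra.
Qed.

(** Bad pairs are sorted by target and by [option 'I_M]: [None] for progress, [Some a] for overshoot
    with colour [a] seen from the target. Each class contributes at most [8 * D]. *)
Lemma sum_bad (T : seq nat) i s j (D : R) :
  (forall a b, (i <= a <= j)%N -> (i <= b <= j)%N -> mdist (p a) (p b) <= D) ->
  all (leq j) T -> blocks i s j -> all (fun e => bad p T e.1 e.2) s ->
  sum_dist p s <= (size T * M.+1)%:R * (8 * D).
Proof.
move=> diam jT bs badT.
have D0 : 0 <= D.
  apply: le_trans (diam i i _ _); rewrite ?mdist_ge0 //;
  by rewrite leqnn (blocks_leq _ _ _ bs).
pose P x (c : option 'I_M) (e : nat * nat) := if c is Some a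
  then overshoot p x e.1 e.2 && (dir (p x) (p e.2) == a)
  else progress p x e.1 e.2.
have one x c : (j <= x)%N -> sum_dist p [seq e <- s | P x c e] <= 8 * D.
  move=> jx; have := blocks_filter (P x c) _ _ _ bs.
  have := filter_all (P x c) s.
  have diamx a b : (i <= a <= j)%N -> (i <= b <= j)%N ->
      mdist (p a) (p x) - mdist (p b) (p x) <= D.
    move=> ai bi; have := diam a b ai bi.
    by have := metric_triangle (p a) (p b) (p x); lra.
  case: c => [a|]; last first.
    move=> aP bP; apply: le_trans (sum_progress _ _ _ _ _ sc jx bP aP) _.
    have ij := blocks_leq _ _ _ bs.
    by have := diamx i j; rewrite !leqnn ij => /(_ isT isT); lra.
  (* The first interval of a colour class has no predecessor: its chord is bounded by [D], and its
     endpoint starts the telescoping. *)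
  case: [seq e <- s | _] => [|[b v] s'] /=; first by rewrite /sum_dist big_nil; lra.
  move=> /andP[/andP[_ /eqP dv] aP] /and3P[ib bv bs'].
  have := sum_overshoot _ _ _ _ _ _ (leqnn v) jx dv bs' aP.
  have vj := blocks_leq _ _ _ bs'.
  rewrite /sum_dist big_cons /=.
  have bj := leq_trans bv vj; have iv := leq_trans ib bv.
  have := diam b v; rewrite ib bj iv vj.
  move=> /(_ isT isT).
  have := diamx v j; rewrite iv vj (leq_trans iv vj) leqnn.
  by move=> /(_ isT isT); lra.
have le1 : sum_dist p s <= \sum_(x <- T) \sum_c sum_dist p [seq e <- s | P x c e].
  have -> : \sum_(x <- T) \sum_c sum_dist p [seq e <- s | P x c e] =
      \sum_(e <- s) \sum_(x <- T) \sum_c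
        if P x c e then mdist (p e.1) (p e.2) else 0.
    rewrite [RHS]exchange_big /=; apply: eq_bigr => x _.
    rewrite [RHS]exchange_big /=; apply: eq_bigr => c _.
    by rewrite /sum_dist big_filter big_mkcond.
  rewrite /sum_dist big_seq [leRHS]big_seq; apply: ler_sum => e es.
  have /hasP[x xT bx] := allP badT e es.
  rewrite (big_rem x xT) /=.
  have ge0 y c : 0 <= (if P y c e then mdist (p e.1) (p e.2) else 0).
    by case: ifP => // _; exact: mdist_ge0.
  apply: ler_wpDr; first by apply: sumr_ge0 => y _; apply: sumr_ge0.
  pose c := if progress p x e.1 e.2 then None else Some (dir (p x) (p e.2)).
  rewrite (bigD1 c) //= ifT; first by apply: ler_wpDr => //; apply: sumr_ge0.
  by move: bx; rewrite /c; case: ifP => [//|_] /= ->; rewrite eqxx.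
apply: le_trans le1 _.
apply: (@le_trans _ _ (\sum_(x <- T) \sum_(c : option 'I_M) 8 * D)).
  rewrite big_seq [leRHS]big_seq; apply: ler_sum => x xT.
  by apply: ler_sum => c _; apply: one; exact: (allP jT).
rewrite big_tnth; under eq_bigr do rewrite sumr_const card_option card_ord.
rewrite sumr_const card_ord -mulrnA mulnC [leRHS]mulr_natl.
exact: lexx.
Qed.


(* Greedy decomposition from the right: each time a terminal segment becomes
   longer than [C] times its chord, it is traded for a bad pair. *)
Lemma bad_decomposition (T : seq nat) i j (C E D : R) : 0 <= C ->
  (forall o v, (i <= o)%N -> (o < v)%N -> (v <= j)%N ->
     (forall o', (o < o')%N -> (o' <= v)%N ->
        seq_length p o' v <= C * mdist (p o') (p v)) ->
     C * mdist (p o) (p v) < seq_length p o v ->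
     exists b, [/\ (o <= b)%N, (b <= v)%N, bad p T b v &
       seq_length p o v <= E * mdist (p b) (p v)]) ->
  forall v, (i <= v)%N -> (v <= j)%N ->
  (forall a, (i <= a <= v)%N -> mdist (p i) (p a) <= D) ->
  exists s, [/\ blocks i s v, all (fun e => bad p T e.1 e.2) s &
    seq_length p i v <= C * D + E * sum_dist p s].
Proof.
move=> C0 step; elim/ltn_ind => v IHv iv vj diam.
pose Q o := (i <= o <= v)%N && (C * mdist (p o) (p v) < seq_length p o v).
have [[k Qk]|nQ] := pselect (exists o, Q o); last first.
  exists [::]; split => //; rewrite /sum_dist big_nil mulr0 addr0.
  have : ~~ Q i by apply/negP => Qi; apply: nQ; exists i.
  rewrite /Q leqnn iv /= -leNgt => /le_trans; apply.
  by apply: ler_wpM2l => //; apply: diam; rewrite iv leqnn.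
have Qv o : Q o -> (o <= v)%N by move=> /andP[/andP[]].
case: (ex_maxnP (ex_intro _ k Qk) Qv) => o /andP[/andP[io ov] long] omax.
(* Strictness of [long] excludes [o = v], so the induction on [v] applies to [o]. *)
have ltov : (o < v)%N.
  rewrite ltn_neqAle ov andbT; apply: contraTneq long => ->.
  by rewrite seq_lengthnn mdistxx mulr0 ltxx.
have short o' : (o < o')%N -> (o' <= v)%N ->
    seq_length p o' v <= C * mdist (p o') (p v).
  move=> oo' o'v; rewrite leNgt; apply/negP => Qo'; have := omax o'.
  by rewrite /Q Qo' o'v (leq_trans io (ltnW oo')) leqNgt oo' => /(_ isT).
have [b [ob bv bad_bv lenov]] := step o v io ltov vj short long.
have [a /andP[ia ao]|s [bs bads lens]] := IHv o ltov io (leq_trans ov vj).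
  by apply: diam; rewrite ia (leq_trans ao).
exists (rcons s (b, v)); split; first exact: blocks_rcons bs ob bv.
  by rewrite all_rcons bad_bv.
by rewrite (seq_length_cat o) // sum_dist_rcons mulrDr addrA lerD.
Qed.

(** * Induction on the number of targets *)

Definition distinct_directions (T : seq nat) i j : Prop :=
  forall o, (i <= o <= j)%N -> uniq [seq dir (p o) (p x) | x <- T].

(** The threshold [4 * C + 4] is twice [2 * C + 2], which bounds, in units of d(p_o,p_v), the part
    before [b] and the jump into [b]; so [b, v] carries more than half of the length. *)
Lemma long_segment_bad (T : seq nat) o v (C : R) : 0 <= C ->
  (forall b D, (o <= b < v)%N -> distinct_directions (v :: T) o b ->
     (forall a c, (o <= a <= b)%N -> (o <= c <= b)%N -> mdist (p a) (p c) <= D) ->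
     seq_length p o b <= C * D) ->
  (o < v)%N -> all (leq v) T -> distinct_directions T o v ->
  (forall o', (o < o')%N -> (o' <= v)%N ->
     seq_length p o' v <= (4 * C + 4) * mdist (p o') (p v)) ->
  (4 * C + 4) * mdist (p o) (p v) < seq_length p o v ->
  exists b, [/\ (o <= b)%N, (b <= v)%N, bad p T b v &
    seq_length p o v <= (8 * C + 12) * mdist (p b) (p v)].
Proof.
move=> C0 shortC ov vT Tdir short long.
have diam a c : (o <= a <= v)%N -> (o <= c <= v)%N ->
    mdist (p a) (p c) <= 2 * mdist (p o) (p v).
  move=> /andP[oa av] /andP[oc cv].
  have := metric_triangle (p a) (p v) (p c); rewrite (metric_sym (p v)).
  by have := sc o a v oa av; have := sc o c v oc cv; lra.
pose Q b := (o <= b)%N && ((b == v) || bad p T b v).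
have Qv : Q v by rewrite /Q (ltnW ov) eqxx.
case: (ex_minnP (ex_intro _ v Qv)) => b /andP[ob Qb] bmin.
have bv : (b <= v)%N by apply: bmin.
have dov := mdist_ge0 (p o) (p v).
(* If [b = o], nothing precedes [b]; as [short] starts only at [o.+1], the first jump is split
   off. *)
move: ob; rewrite leq_eqVlt => /orP[/eqP ob|ob].
  exists o; split => //; first exact: ltnW.
    by move: Qb; rewrite -ob (ltn_eqF ov).
  rewrite (seq_length_cat o.+1) // seq_lengthS.
  have := short o.+1 (leqnn _) ov.
  have := diam o o.+1; rewrite leqnn (ltnW ov) leqnSn ov => /(_ isT isT).
  by have := sc o o.+1 v (leqnSn o) ov; move: C0 dov; nra.
(* From here on the first index found is [b.+1], and [b] is its predecessor. *)
case: b ob Qb bv bmin => [//|b] ob Qb bv bmin.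
have nbad o' : (o <= o' <= b)%N -> ~~ bad p T o' v.
  move=> /andP[oo' o'b]; apply/negP => bo'.
  by have := bmin o'; rewrite /Q oo' bo' orbT ltnNge o'b => /(_ isT).
have vTdir : distinct_directions (v :: T) o b.
  move=> o' /andP[oo' o'b] /=; have o'v := leq_trans o'b (ltnW bv).
  rewrite Tdir ?oo' // andbT; apply/mapP => -[x xT].
  have := nbad o'; rewrite oo' o'b => /(_ isT)/hasPn/(_ x xT).
  rewrite negb_or => /andP[npr nov].
  by apply/eqP; apply: not_bad_dir => //; apply: (allP vT).
have lenob : seq_length p o b <= C * (2 * mdist (p o) (p v)).
  apply: shortC => // [|a c /andP[oa ab] /andP[oc cb]]; first exact/andP.
  by apply: diam; apply/andP; split=> //; apply: leq_trans (ltnW bv).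
have dbb : mdist (p b) (p b.+1) <= 2 * mdist (p o) (p v).
  by apply: diam; rewrite ?(ltnW bv) ?bv ?(ltnW ob) // -ltnS ob.
have lenE : seq_length p o v =
    seq_length p o b + mdist (p b) (p b.+1) + seq_length p b.+1 v.
  by rewrite (seq_length_cat b) ?(ltnW bv) // (seq_length_cat b.+1 b) // seq_lengthS addrA.
have lenbv := short b.+1 ob bv.
exists b.+1; split => //; first exact: ltnW.
  (* If the first index were [v], nothing would follow it and the length would stay below the
     threshold. *)
  move: Qb => /orP[/eqP bvE|//].
  have dbv0 : mdist (p b.+1) (p v) = 0 by rewrite bvE mdistxx.
  by move: lenbv; rewrite dbv0 mulr0; move: long lenE lenob dbb C0 dov; nra.
by have := mdist_ge0 (p b.+1) (p v); move: long lenE lenob dbb C0 dov lenbv; nra.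
Qed.

End Directions.

Lemma seq_length_bound_targets (B : set X) M (dir : X -> X -> 'I_M) m k :
  direction_map B M dir -> (k + m = M.+1)%N ->
  exists2 C : R, 0 <= C & forall p T i j (D : R),
    self_contracted_seq p -> (forall l, B (p l)) ->
    size T = k -> (i <= j)%N -> all (leq j) T ->
    distinct_directions M dir p T i j ->
    (forall a b, (i <= a <= j)%N -> (i <= b <= j)%N -> mdist (p a) (p b) <= D) ->
    seq_length p i j <= C * D.
Proof.
move=> dirP; elim: m k => [|m IHm] k kM.
  exists 0 => // p T i j D _ _ sT ij _ /(_ i).
  rewrite leqnn ij => /(_ isT) /card_uniqP; rewrite size_map sT => cardT.
  have := max_card [in [seq dir (p i) (p x) | x <- T]].
  by rewrite cardT card_ord; lia.
have [|C C0 bndC] := IHm k.+1; first by rewrite addSnnS.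
(* The first part pays for the remainder in [bad_decomposition], the product for its bad pairs via
   [sum_bad]. *)
exists (4 * C + 4 + (8 * C + 12) * ((k * M.+1)%:R * 8)).
  by rewrite addr_ge0 ?mulr_ge0 //; lra.
move=> p T i j D sc pB sT ij jT Tdir diam.
have step o v : (i <= o)%N -> (o < v)%N -> (v <= j)%N ->
    (forall o', (o < o')%N -> (o' <= v)%N ->
       seq_length p o' v <= (4 * C + 4) * mdist (p o') (p v)) ->
    (4 * C + 4) * mdist (p o) (p v) < seq_length p o v ->
    exists b, [/\ (o <= b)%N, (b <= v)%N, bad p T b v &
      seq_length p o v <= (8 * C + 12) * mdist (p b) (p v)].
  move=> io ov vj; apply: (long_segment_bad B M dir dirP) => //; last 2 first.
  - by apply: sub_all jT => x; apply: leq_trans.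
  - by move=> a /andP[oa av]; apply: Tdir; rewrite (leq_trans io oa) (leq_trans av).
  move=> b D' /andP[ob bv] vTdir diam'.
  apply: (bndC p (v :: T)) => //=; first by rewrite sT.
  rewrite (ltnW bv); apply: sub_all jT => x; apply: leq_trans.
  exact: leq_trans (ltnW bv) vj.
have C40 : 0 <= 4 * C + 4 by lra.
have [a /andP[ia aj]|s [bs bads len]] :=
    bad_decomposition p T i j (4 * C + 4) (8 * C + 12) D C40 step j ij (leqnn j).
  by apply: diam; rewrite ?ia ?leqnn.
apply: le_trans len _; rewrite [leRHS]mulrDl lerD2l -mulrA.
apply: ler_wpM2l; first by lra.
rewrite -mulrA -sT; exact: (sum_bad B M dir dirP p sc pB T i s j).
Qed.

Theorem self_contracted_seq_length (B : set X) M (dir : X -> X -> 'I_M) :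
  direction_map B M dir -> exists C : R, forall p n (D : R),
    self_contracted_seq p -> (forall l, B (p l)) ->
    (forall a b, mdist (p a) (p b) <= D) ->
    seq_length p 0 n <= C * D.
Proof.
move=> dirP; have [C _ bnd] := seq_length_bound_targets B M dir M.+1 0 dirP erefl.
by exists C => p n D sc pB diam; apply: (bnd p [::]).
Qed.
End SelfContractedSequences.

(** * Compactness *)

(* If [A] were not [J], the complements of [J]-sets would generate a proper
   filter containing [A] without cluster point. *)
Lemma compact_locally_ideal {T : topologicalType} (A : set T) (J : set T -> Prop) :
  compact A -> J set0 -> (forall S S', S `<=` S' -> J S' -> J S) ->
  (forall S S', J S -> J S' -> J (S `|` S')) ->
  (forall x, A x -> exists2 U, nbhs x U & J U) -> J A.
Proof.
move=> cA J0 JS JU Jloc; apply: contrapT => nJA.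
pose F := [set S : set T | exists2 B, J B & A `\` B `<=` S].
have FA : F A by exists set0 => // x [].
have PF : ProperFilter F.
  split.
    move=> [B JB AB]; apply: nJA; apply: (JS _ B) => // x Ax.
    by apply: contrapT => nBx; apply: (AB x).
  split; first by exists set0.
    move=> P Q [B JB BP] [C JC CQ]; exists (B `|` C); first exact: JU.
    by move=> x [Ax nBC]; split; [apply: BP|apply: CQ]; split => // ?;
      apply: nBC; [left|right].
  by move=> P Q PQ [B JB BP]; exists B => // x /BP/PQ.
have [x [Ax clx]] := cA F PF FA.
have [U Ux JUU] := Jloc x Ax.
have FU : F (~` U) by exists U => // y [].
by have [y [nUy Uy]] := clx _ _ FU Ux.
Qed.

Lemma locally_compact_nbhs {X : topologicalType} (x : X) :
  locally_compact [set: X] -> exists2 K, nbhs x K & compact K.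
Proof.
move=> /(_ x I)[K xK [cK _]]; exists K => //.
by move: xK; rewrite /within /=; apply: filterS => y; apply.
Qed.

Section Compactness.
Context {R : realType} {X : metricType R}.
Implicit Types (A B : set X) (x y z : X) (e r : R).

Lemma ball_mdist x r y : ball x r y <-> mdist x y < r.
Proof. by rewrite ballEmdist. Qed.

Definition totally_bounded A : Prop := forall e, 0 < e ->
  exists s : seq X, forall y, A y -> exists2 x, x \in s & mdist x y < e.

Lemma totally_boundedU A B :
  totally_bounded A -> totally_bounded B -> totally_bounded (A `|` B).
Proof.
move=> tA tB e e0; have [s sA] := tA e e0; have [t tBt] := tB e e0.
exists (s ++ t) => y [/sA|/tBt] [x xs xy]; exists x => //;
by rewrite mem_cat xs ?orbT.
Qed.

Lemma totally_boundedS A B :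
  A `<=` B -> totally_bounded B -> totally_bounded A.
Proof. by move=> AB tB e /tB[s sB]; exists s => y /AB/sB. Qed.

Lemma compact_totally_bounded A : compact A -> totally_bounded A.
Proof.
move=> cA e e0; pose J S := exists s : seq X, forall y, S y ->
  exists2 x, x \in s & mdist x y < e.
apply: (compact_locally_ideal A J) => //.
- by exists [::].
- by move=> S S' SS' [s sS]; exists s => y /SS'/sS.
- move=> S S' [s sS] [t tS']; exists (s ++ t) => y [/sS|/tS'] [x xs xy];
  by exists x => //; rewrite mem_cat xs ?orbT.
- move=> x _; exists (ball x e); first exact: nbhsx_ballx.
  by exists [:: x] => y /ball_mdist; exists x => //; rewrite inE.
Qed.

Lemma ultra_seq_cover (F : set_system X) (s : seq X) (P : X -> set X) :
  UltraFilter F -> F [set y | exists2 x, x \in s & P x y] ->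
  exists x, F (P x).
Proof.
move=> UF; elim: s => [|a s IHs] Fs.
  have := @filter_not_empty _ F _; case.
  by apply: filterS Fs => y [].
have [Fa|Fna] := in_ultra_setVsetC (P a) UF; first by exists a.
apply: IHs; near=> y.
have : [set y | exists2 x, x \in a :: s & P x y] y by near: y.
move=> [x]; rewrite inE => /orP[/eqP->|xs Pxy]; last by exists x.
have : (~` P a) y by near: y.
by [].
Unshelve. all: by end_near. Qed.

(** An ultrafilter containing [A] selects one ball of each finite net, hence is Cauchy. *)
Lemma totally_bounded_compact A :
  complete_space X -> closed A -> totally_bounded A -> compact A.
Proof.
move=> cX cA tA; rewrite compact_ultra => F UF FA.
have Fc : cauchy F.
  apply: cauchy_exP => e e0; have [s sA] := tA e e0.
  have [|x] := ultra_seq_cover F s (fun x => [set y | mdist x y < e]) UF.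
    by apply: filterS FA => y /sA.
  by move=> Fx; exists x; rewrite ballEmdist.
have [x Fx] := cX F _ Fc; exists x; split => //.
apply: cA => U Ux; have FU : F U by exact: Fx.
by have [y [Ay Uy]] := filter_ex (filterI FA FU); exists y.
Qed.

Lemma closed_mdist_le x r : closed [set y | mdist x y <= r].
Proof.
move=> y cly /=; apply/ler_addgt0Pr => e e0.
have [z [/= xz /ball_mdist yz]] := cly _ (nbhsx_ballx y e e0).
by have := metric_triangle x z y; rewrite (metric_sym z); lra.
Qed.

End Compactness.

(** * Geodesics and the Hopf-Rinow theorem *)

Section Geodesics.
Context {R : realType} {X : metricType R}.
Implicit Types (x y z : X) (g h : R -> X) (a b r s t : R).

Lemma mdist_continuous x : continuous (mdist x : X -> R).
Proof.
move=> y; apply/cvgrPdist_lt => e e0; near=> z.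
have /ball_mdist : ball y e z by near: z; exact: nbhsx_ballx.
have := metric_triangle x y z; have := metric_triangle x z y.
by rewrite (metric_sym z) ltr_norml; lra.
Unshelve. all: by end_near. Qed.

Section Reparametrization.
Variables (g : R -> X) (a b : R).
Hypothesis glen : curve_length `[a, b] g = (mdist (g a) (g b))%:E.

Lemma chain_length_le (s : seq R) : sorted <%R s -> [set` s] `<=` `[a, b] ->
  chain_length g s <= mdist (g a) (g b).
Proof.
by move=> ss sab; rewrite -lee_fin -glen; apply: ereal_sup_ubound; exists s.
Qed.

Lemma geodesic_split t : a <= t <= b ->
  mdist (g a) (g t) + mdist (g t) (g b) <= mdist (g a) (g b).
Proof.
(* Chains are strictly increasing, so coinciding parameters are treated apart. *)
move=> /andP[]; rewrite le_eqVlt => /orP[/eqP <- _|lt_at].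
  by rewrite mdistxx add0r.
rewrite le_eqVlt => /orP[/eqP ->|lt_tb]; first by rewrite mdistxx addr0.
have := chain_length_le [:: a; t; b]; rewrite /chain_length /= lt_at lt_tb.
rewrite big_nat_recl // big_nat1 /=; apply => // u /= us; rewrite in_itv /=; move: us; rewrite !inE.
by move=> /or3P[] /eqP ->; lra.
Qed.

Lemma geodesic_split2 t u : a <= t -> t <= u -> u <= b ->
  mdist (g a) (g t) + mdist (g t) (g u) + mdist (g u) (g b) <= mdist (g a) (g b).
Proof.
rewrite le_eqVlt => /orP[/eqP <- au ub|lt_at].
  by rewrite mdistxx add0r geodesic_split ?au.
rewrite le_eqVlt => /orP[/eqP <- tb|lt_tu].
  by rewrite mdistxx addr0 geodesic_split // (ltW lt_at).
rewrite le_eqVlt => /orP[/eqP ub|lt_ub].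
  by rewrite ub mdistxx addr0 geodesic_split // (ltW lt_at) -ub ltW.
have := chain_length_le [:: a; t; u; b].
rewrite /chain_length /= lt_at lt_tu lt_ub.
rewrite big_nat_recl // big_nat_recl // big_nat1 addrA /=.
apply => // v /= vs; rewrite in_itv /=; move: vs; rewrite !inE.
by move=> /or4P[] /eqP ->; lra.
Qed.

(* Along a shortest curve, the distance to the starting point serves as an
   arc length parameter. *)
Lemma geodesic_isometric t u : a <= t <= b -> a <= u <= b ->
  mdist (g t) (g u) = `|mdist (g a) (g t) - mdist (g a) (g u)|.
Proof.
wlog tu : t u / t <= u => [hwlog|].
  by have [?|/ltW ?] := leP t u => ? ?; [|rewrite metric_sym distrC]; exact: hwlog.
move=> /andP[lt_at tb] /andP[au ub].
have := geodesic_split2 t u lt_at tu ub.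
have := metric_triangle (g a) (g u) (g b).
have := metric_triangle (g a) (g t) (g u).
have := mdist_ge0 (g t) (g u).
by move=> *; rewrite distrC ger0_norm; lra.
Qed.

End Reparametrization.

(** The intermediate value theorem finds a point of the curve at each distance from [x]; by
    [geodesic_isometric] any choice of such points is parametrized by arc length. *)
Lemma unit_speed_geodesic x y : geodesic_space X -> 0 < mdist x y ->
  exists h, [/\ unit_speed_minimizing (mdist x y) h, h 0 = x & h (mdist x y) = y].
Proof.
move=> /(_ x y)[a [b [g [ab cg ga gb glen]]]] xy0.
have cf : {within `[a, b], continuous (mdist x \o g)}.
  by move=> t; exact: cvg_comp (cg t) (mdist_continuous x (g t)).
have /choice[tau tauP] : forall s, exists t, s \in `[0, mdist x y] ->
    a <= t <= b /\ mdist x (g t) = s.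
  move=> s; have [sL|nsL] := boolP (s \in `[0, mdist x y]); last first.
    by exists a => sL; rewrite sL in nsL.
  have [|t] := IVT (v := s) ab cf.
    rewrite /= ga gb mdistxx (min_l (ltW xy0)) (max_r (ltW xy0)).
    by move: sL; rewrite in_itv /=.
  by rewrite in_itv /= => tab ft; exists t.
rewrite -ga -gb in glen.
exists (g \o tau); split.
- split => // s t sL tL /=; have [stab es] := tauP s sL.
  have [ttab et] := tauP t tL.
  by rewrite (geodesic_isometric g a b glen) // ga es et.
- have [|_ /= h0] := tauP 0; first by rewrite in_itv /= lexx ltW.
  by apply/esym/mdist_positivity.
- have [|tab /= hL] := tauP (mdist x y); first by rewrite in_itv /= lexx ltW.
  apply: mdist_positivity; have := geodesic_split g a b glen _ tab.
  by rewrite ga gb hL; have := mdist_ge0 (g (tau (mdist x y))) y; lra.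
Qed.

Lemma geodesic_point x y r : geodesic_space X -> 0 <= r <= mdist x y ->
  exists z, mdist x z = r /\ mdist z y = mdist x y - r.
Proof.
move=> gX /andP[r0 rL]; have [L0|] := ltP 0 (mdist x y); last first.
  by move=> L0; exists x; rewrite mdistxx; lra.
have [h [[_ hd] h0 hL]] := unit_speed_geodesic x y gX L0.
have r_in : r \in `[0, mdist x y] by rewrite in_itv /= r0.
have z_in : 0 \in `[0, mdist x y] by rewrite in_itv /= lexx ltW.
have L_in : mdist x y \in `[0, mdist x y] by rewrite in_itv /= lexx ltW.
exists (h r); split.
  by rewrite -{1}h0 hd // sub0r normrN ger0_norm.
by rewrite -{1}hL hd // distrC ger0_norm ?subr_ge0.
Qed.

(** Let [c] be the supremum of the good radii. The ball of radius [c] is itself good, hence compact,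
    so local compactness gives a totally bounded uniform neighbourhood; by geodesics it contains a
    larger ball. *)
Lemma closed_ball_totally_bounded x : complete_space X ->
  locally_compact [set: X] -> geodesic_space X ->
  forall r, totally_bounded [set y | mdist x y <= r].
Proof.
move=> cX lcX gX r1; apply: contrapT => nr1.
pose S := [set r | totally_bounded [set y : X | mdist x y <= r]].
have S1 r : S r -> r <= r1.
  move=> Sr; rewrite leNgt; apply/negP => r1r; apply: nr1.
  by apply: totally_boundedS Sr => y /=; lra.
have S0 : S 0.
  move=> e e0; exists [:: x] => y /= xy; exists x; first by rewrite inE.
  by lra.
have supS : has_sup S by split; [exists 0|exists r1 => r /S1].
have ubS r : S r -> r <= sup S by move=> Sr; apply: ub_le_sup Sr; exists r1 => ? /S1.
have c0 := ubS 0 S0; pose c := sup S; rewrite -/c in c0 ubS.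
have retract r d y : 0 <= r -> 0 <= d -> mdist x y <= r + d ->
    exists2 z, mdist x z <= r & mdist z y <= d.
  move=> r0 d0 xy; have [le|/ltW lt] := leP (mdist x y) r.
    by exists y => //; rewrite mdistxx.
  have [|z [xz zy]] := geodesic_point x y r gX; first by rewrite r0.
  by exists z; lra.
have Sc : S c.
  move=> e e0; have e2 : 0 < e / 2 by lra.
  have [r Sr rc] := sup_adherent e2 supS; rewrite -/c in rc.
  (* The radius [r] may be negative, where [retract] does not apply. *)
  have Sm : S (Num.max r 0) by have [|] := leP r 0.
  have [s sP] := Sm _ e2; exists s => y /= xy.
  have [|||z xz zy] := retract (Num.max r 0) (e / 2) y.
  - by rewrite le_max lexx orbT.
  - exact: ltW.
  - have : r <= Num.max r 0 by rewrite le_max lexx.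
    by lra.
  have [u us uz] := sP z xz; exists u => //.
  by have := metric_triangle u z y; lra.
pose J A := exists2 d, 0 < d &
  totally_bounded [set w : X | exists2 u, A u & mdist u w < d].
have [d d0 td] : J [set y | mdist x y <= c].
  apply: compact_locally_ideal.
  - exact: totally_bounded_compact cX (closed_mdist_le x c) Sc.
  - by exists 1 => // e _; exists [::] => y [].
  - move=> A B AB [d d0 tB]; exists d => //.
    by apply: totally_boundedS tB => w [u /AB Bu uw]; exists u.
  - move=> A B [d d0 tA] [d' d'0 tB]; exists (Num.min d d').
      by rewrite lt_min d0.
    apply: totally_boundedS (totally_boundedU _ _ tA tB) => w [u ABu].
    by rewrite lt_min => /andP[uw uw']; case: ABu => ?; [left|right]; exists u.
  - move=> z _; have [K /nbhs_ballP[d /= d0 dK] cK] := locally_compact_nbhs z lcX.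
    have d2 : 0 < d / 2 by lra.
    exists (ball z (d / 2)); first exact: nbhsx_ballx.
    exists (d / 2) => //; apply: totally_boundedS (compact_totally_bounded _ cK).
    move=> w [u /ball_mdist zu uw]; apply/dK/ball_mdist.
    by have := metric_triangle z u w; lra.
have : S (c + d / 2).
  apply: totally_boundedS td => w /= xw.
  have [|z xz zw] := retract c (d / 2) w c0 _ xw; first by lra.
  by exists z => //; lra.
by move=> /ubS; lra.
Qed.

End Geodesics.

(** * Directions under LEG and LRB *)

Section LocalDirections.
Context {R : realType} {X : metricType R}.
Implicit Types (x y z o : X) (g h : R -> X).

Lemma unit_speed_restrict (S T : R) h : 0 < S -> S <= T ->
  unit_speed_minimizing T h -> unit_speed_minimizing S h.
Proof.
move=> S0 ST [_ hd]; split => // s t; rewrite !in_itv /=.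
by move=> /andP[s0 sS] /andP[t0 tS]; apply: hd; rewrite in_itv /=; lra.
Qed.

Lemma unit_speed_near x (T : R) h (t : R) :
  unit_speed_minimizing T h -> t \in `[0, T] ->
  mdist x (h t) <= mdist x (h 0) + t.
Proof.
move=> [T0 hd] tT; have := tT; rewrite in_itv /= => /andP[t0 _].
have := metric_triangle x (h 0) (h t); rewrite (hd 0 t) //.
  by rewrite sub0r normrN ger0_norm.
by rewrite in_itv /= lexx ltW.
Qed.

(* [dir o y] records which point of a finite net is close to the endpoint of
   an extension of length [lam] of a geodesic from [o] to [y]. *)
Theorem local_direction_map x (e H K : R) :
  locally_compact [set: X] -> geodesic_space X ->
  0 < e -> LEG_at x e -> 0 < H -> 0 < K -> LRB_at x H K ->
  exists2 r, 0 < r & exists M (dir : X -> X -> 'I_M), direction_map (ball x r) M dir.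
Proof.
move=> lcX gX e0 leg H0 K0 lrb.
have [U /nbhs_ballP[d /= d0 dU] cU] := locally_compact_nbhs x lcX.
(* The ball of radius [2 * lam] about [x] fits into the three given balls and contains all geodesics
   of length [lam] issuing from [ball x r]. *)
pose lam := Num.min (Num.min e H) d / 2.
have [lam0 lame lamH lamd] : [/\ 0 < lam, 2 * lam <= e, 2 * lam <= H & 2 * lam <= d].
  have -> : 2 * lam = Num.min (Num.min e H) d by rewrite /lam; lra.
  rewrite !ge_min !lexx ?orbT; split => //.
  by rewrite divr_gt0 // !lt_min e0 H0.
pose r := lam / 4; have r0 : 0 < r by rewrite divr_gt0.
(* Makes the LRB estimate [K * (mdist o y / lam) * delta] equal to [mdist o y / 8], the error
   allowed by [direction_map]. *)
pose delta := lam / (8 * K).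
have delta0 : 0 < delta by apply: divr_gt0 => //; lra.
have [|s sP] := compact_totally_bounded _ cU (delta / 2); first by rewrite divr_gt0.
have ballr y : ball x r y -> mdist x y < lam / 4 by move=> /ball_mdist.
have extend o y : ball x r o -> ball x r y -> 0 < mdist o y ->
    exists h, [/\ unit_speed_minimizing lam h, h 0 = o & h (mdist o y) = y].
  move=> /ballr xo /ballr xy oy0.
  have oyl : mdist o y < lam / 2.
    by have := metric_triangle o x y; rewrite (metric_sym o x); lra.
  have [g [ug g0 gL]] := unit_speed_geodesic o y gX oy0.
  have [t tL|h uh hg] := leg _ g ug.
    apply/ball_mdist; apply: le_lt_trans (unit_speed_near x _ _ _ ug tL) _.
    by move: tL; rewrite g0 in_itv /=; lra.
  exists h; split; first by apply: unit_speed_restrict uh => //; lra.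
    by rewrite hg // in_itv /= lexx ltW.
  by rewrite hg // in_itv /= lexx ltW.
have near_x o h t : ball x r o -> unit_speed_minimizing lam h -> h 0 = o ->
    t \in `[0, lam] -> mdist x (h t) < 2 * lam.
  move=> /ballr xo uh h0 tl; have := unit_speed_near x _ _ _ uh tl.
  by move: tl; rewrite h0 in_itv /=; lra.
have lam_in : lam \in `[0, lam] by rewrite in_itv /= lexx ltW.
(* The extra colour keeps the index type inhabited, giving a default for pairs without an
   extension. *)
have /choice[dir dirP] : forall oy : X * X, exists k : 'I_(size s).+1,
    ball x r oy.1 -> ball x r oy.2 -> 0 < mdist oy.1 oy.2 ->
    exists h, [/\ unit_speed_minimizing lam h, h 0 = oy.1, h (mdist oy.1 oy.2) = oy.2
      & mdist (nth x s k) (h lam) < delta / 2].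
  case=> o y /=; have [[xo [xy oy0]]|no] :=
      pselect (ball x r o /\ ball x r y /\ 0 < mdist o y); last first.
    by exists ord0 => xo xy oy0; case: no.
  have [h [uh h0 hL]] := extend o y xo xy oy0.
  have [|z zs zh] := sP (h lam).
    by apply/dU/ball_mdist; apply: lt_le_trans (near_x o h lam xo uh h0 lam_in) lamd.
  exists (inord (index z s)) => _ _ _; exists h; split => //.
  by rewrite inordK ?nth_index // ltnS index_size.
exists r => //; exists (size s).+1, (fun o y => dir (o, y)) => o y z xo xy xz eqd oyz.
have [oy0|] := ltP 0 (mdist o y); last first.
  move=> oy; have oy0 : mdist o y = 0 by apply: le_anti; rewrite oy mdist_ge0.
  by rewrite oy0 (mdist_positivity _ _ oy0); lra.
have oz0 := lt_le_trans oy0 oyz.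
have [h [uh h0 hy hdir]] := dirP (o, y) xo xy oy0.
have [k [uk k0 kz kdir]] := dirP (o, z) xo xz oz0.
rewrite /= in eqd hdir kdir h0 k0 hy kz.
have hk : mdist (h lam) (k lam) <= delta.
  have := metric_triangle (h lam) (nth x s (dir (o, z))) (k lam).
  by move: hdir; rewrite eqd (metric_sym _ (h lam)); lra.
have ozl : mdist o z < lam.
  have := metric_triangle o x z; rewrite (metric_sym o x).
  by move: (ballr _ xo) (ballr _ xz); lra.
have tE : mdist o y / lam * lam = mdist o y by rewrite divfK // gt_eqF.
(* At this time [h] is at [y], and [k] is on the way to [z] at the same distance from [o]. *)
have := lrb lam lam h k uh uk _ _ _ (mdist o y / lam).
rewrite tE h0 k0 hy => bus.
have {}bus : mdist y (k (mdist o y)) <= K * (mdist o y / lam) * mdist (h lam) (k lam).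
  apply: bus => //.
  - by move=> t tl; apply/ball_mdist; apply: lt_le_trans (near_x o h t xo uh h0 tl) lamH.
  - by move=> t tl; apply/ball_mdist; apply: lt_le_trans (near_x o k t xo uk k0 tl) lamH.
  - rewrite in_itv /=; apply/andP; split; first by apply: divr_ge0; exact: ltW.
    by rewrite ler_pdivrMr // mul1r; lra.
have {}bus : mdist y (k (mdist o y)) <= mdist o y / 8.
  apply: le_trans bus _; apply: (@le_trans _ _ (K * (mdist o y / lam) * delta)).
    by apply: ler_wpM2l => //; apply: mulr_ge0; [|apply: divr_ge0]; exact: ltW.
  have -> : K * (mdist o y / lam) * delta = mdist o y / 8 by rewrite /delta; field; lra.
  exact: lexx.
have kyz : mdist (k (mdist o y)) z = mdist o z - mdist o y.
  case: uk => _ uk; rewrite -{1}kz uk ?in_itv /=; try lra.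
  by rewrite distrC ger0_norm; lra.
by have := metric_triangle y (k (mdist o y)) z; lra.
Qed.

End LocalDirections.

(** * Self-contracted curves *)

Section Chains.
Context {R : realType} {X : metricType R}.
Variables (I : set R) (g : R -> X).
Implicit Types (s : seq R) (x y : X).

Lemma chain_length_cons a b s :
  chain_length g (a :: b :: s) = mdist (g a) (g b) + chain_length g (b :: s).
Proof. by rewrite /chain_length /= big_nat_recl. Qed.

Lemma chain_length_behead a s : chain_length g s <= chain_length g (a :: s).
Proof.
case: s => [|b s]; first by rewrite /chain_length !big_geq.
by rewrite chain_length_cons lerDr mdist_ge0.
Qed.

(** Consecutive points that both satisfy [P] stay consecutive after filtering. *)
Lemma chain_length_filter (P : pred R) s :
  \sum_(0 <= i < (size s).-1 | P s`_i && P s`_i.+1) mdist (g s`_i) (g s`_i.+1)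
  <= chain_length g [seq t <- s | P t].
Proof.
elim: s => [|a [|b s] IHs]; first by rewrite /chain_length !big_geq.
  rewrite big_geq //; apply: sumr_ge0 => i _; exact: mdist_ge0.
rewrite big_mkcond big_nat_recl // -big_mkcond /=.
case: (P a) => /=; last by rewrite add0r.
move: IHs; rewrite /=; case: (P b) => IHs /=.
  by rewrite chain_length_cons lerD2l.
by rewrite add0r; apply: le_trans IHs (chain_length_behead _ _).
Qed.

Lemma rectifiableP : (exists C, forall s, sorted <%R s -> [set` s] `<=` I ->
  chain_length g s <= C) -> rectifiable I g.
Proof.
move=> [C sC]; apply: (@le_lt_trans _ _ C%:E); last exact: ltry.
by apply: ge_ereal_sup => _ [s [ss sI] <-]; rewrite lee_fin sC.
Qed.

Definition rectifiable_within (A : set X) : Prop := exists2 C : R, 0 <= C &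
  forall s, sorted <%R s -> [set` s] `<=` I -> (forall t, t \in s -> A (g t)) ->
    chain_length g s <= C.

Hypothesis gsc : self_contracted I g.

(** Freezing the chain at its last point gives an infinite sequence, as [self_contracted_seq]
    requires. *)
Lemma self_contracted_nth a s : sorted <%R (a :: s) -> [set` a :: s] `<=` I ->
  self_contracted_seq (fun i => g (nth a (a :: s) (minn i (size s)))).
Proof.
move=> ss sI i j k ij jk.
have nthI l : I (nth a (a :: s) (minn l (size s))).
  by apply: sI => /=; rewrite mem_nth //= ltnS geq_minr.
have le_nth l m : (l <= m)%N -> nth a (a :: s) (minn l (size s)) <=
    nth a (a :: s) (minn m (size s)).
  move=> lm; apply: (sorted_leq_nth le_trans lexx) => //.
  - by apply: sub_sorted ss => ? ?; exact: ltW.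
  - by rewrite inE /= ltnS geq_minr.
  - by rewrite inE /= ltnS geq_minr.
  - by rewrite leq_min geq_minr andbT (leq_trans (geq_minl _ _)).
by apply: gsc => //; exact: le_nth.
Qed.

Lemma chain_length_seq_length a s : chain_length g (a :: s) =
  seq_length (fun i => g (nth a (a :: s) (minn i (size s)))) 0 (size s).
Proof.
rewrite /chain_length /seq_length big_nat [RHS]big_nat.
apply: eq_bigr => i /andP[_ /= lt_is].
have e1 : minn i (size s) = i by apply/minn_idPl/ltnW.
have e2 : minn i.+1 (size s) = i.+1 by apply/minn_idPl.
by rewrite e1 e2 !(set_nth_default a 0) //= ltnW.
Qed.

Variables D : R.
Hypothesis D0 : 0 <= D.
Hypothesis diam : forall t u, I t -> I u -> mdist (g t) (g u) <= D.

Lemma direction_map_rectifiable_within (A : set X) M (dir : X -> X -> 'I_M) :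
  direction_map A M dir -> rectifiable_within A.
Proof.
move=> /self_contracted_seq_length[C len].
exists (Num.max 0 (C * D)); first by rewrite le_max lexx.
case=> [|a s] ss sI sA; first by rewrite /chain_length big_geq // le_max lexx.
rewrite le_max chain_length_seq_length; apply/orP; right; apply: len.
- exact: self_contracted_nth.
- by move=> l; apply: sA; rewrite mem_nth //= ltnS geq_minr.
- by move=> l m; apply: diam; apply: sI => /=; rewrite mem_nth //= ltnS geq_minr.
Qed.

(* Self-contractedness makes the endpoints of the jumps of size at least [d]
   pairwise [d]-separated. *)
Lemma big_jumps (net : seq X) (d : R) s :
  (forall t, I t -> exists2 x, x \in net & mdist x (g t) < d / 2) ->
  sorted <%R s -> [set` s] `<=` I ->
  \sum_(0 <= i < (size s).-1 | d <= mdist (g s`_i) (g s`_i.+1))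
    mdist (g s`_i) (g s`_i.+1) <= (size net)%:R * D.
Proof.
move=> netP ss sI.
have nthI i : (i < size s)%N -> I s`_i by move=> /(mem_nth 0)/sI.
have pred_lt i : (i < (size s).-1)%N -> (i.+1 < size s)%N by lia.
have le_nth i j : (i <= j)%N -> (j < size s)%N -> s`_i <= s`_j.
  move=> ij js; apply: (sorted_leq_nth le_trans lexx) => //.
  - by apply: sub_sorted ss => ? ?; exact: ltW.
  - by rewrite inE (leq_ltn_trans ij).
pose f i := find (fun x => mdist x (g s`_i.+1) < d / 2) net.
pose l := [seq i <- index_iota 0 (size s).-1 | d <= mdist (g s`_i) (g s`_i.+1)].
have has_net i : (i < (size s).-1)%N ->
    has (fun x => mdist x (g s`_i.+1) < d / 2) net.
  by move=> /pred_lt/nthI/netP[x xn xi]; apply/hasP; exists x.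
have lP i : i \in l -> (i < (size s).-1)%N /\ d <= mdist (g s`_i) (g s`_i.+1).
  by rewrite mem_filter mem_index_iota => /andP[-> /andP[_ ->]].
have inj i j : i \in l -> j \in l -> (i < j)%N -> f i != f j.
  move=> /lP[li _] /lP[lj dj] ij; apply/eqP => fij.
  have [x0 _] : exists x0 : X, True by exists (g 0).
  have := nth_find x0 (has_net i li); have := nth_find x0 (has_net j lj).
  rewrite -/(f i) -/(f j) fij; set z := nth _ _ _ => zj zi.
  (* The right endpoints of jumps [i < j] share the net point [z], so they are less than [d] apart;
     self-contractedness then makes jump [j] shorter than [d]. *)
  have := gsc s`_i.+1 s`_j s`_j.+1.
  have j1 := pred_lt _ lj.
  move=> /(_ (nthI _ (pred_lt _ li)) (nthI _ (ltnW j1)) (nthI _ j1)).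
  move=> /(_ (le_nth _ _ ij (ltnW j1)) (le_nth _ _ (leqnSn j) j1)).
  have := metric_triangle (g s`_i.+1) z (g s`_j.+1).
  by rewrite (metric_sym _ z); lra.
have size_l : (size l <= size net)%N.
  rewrite -(size_map f) -(size_iota 0 (size net)); apply: uniq_leq_size.
    rewrite map_inj_in_uniq ?filter_uniq ?iota_uniq // => i j il jl fij.
    by have [/(inj i j il jl)|/(inj j i jl il)|//] := ltngtP i j; rewrite fij eqxx.
  move=> _ /mapP[i /lP[li _] ->]; rewrite mem_iota add0n /=.
  by rewrite -has_find has_net.
rewrite -big_filter -/l; apply: (@le_trans _ _ (\sum_(i <- l) D)).
  rewrite big_seq [leRHS]big_seq; apply: ler_sum => i /lP[li _].
  by have i1 := pred_lt _ li; apply: diam; apply: nthI => //; exact: ltnW.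
rewrite big_const_seq count_predT iter_addr_0 -[leLHS]mulr_natl.
by apply: ler_wpM2r => //; rewrite ler_nat.
Qed.

(* Jumps of size less than a Lebesgue number [d] of the cover stay inside one
   of its members. *)
Lemma rectifiable_of_local (net : seq X) (T : eqType) (cover : T -> set X)
    (c : seq T) (d : R) :
  (forall t, I t -> exists2 x, x \in net & mdist x (g t) < d / 2) ->
  (forall a, rectifiable_within (cover a)) ->
  (forall t u, I t -> I u -> mdist (g t) (g u) < d ->
    exists2 a, a \in c & cover a (g t) /\ cover a (g u)) ->
  rectifiable I g.
Proof.
move=> netP rec coverP.
have /choice[C CP] : forall a, exists C, 0 <= C /\ forall s,
    sorted <%R s -> [set` s] `<=` I -> (forall t, t \in s -> cover a (g t)) ->
    chain_length g s <= C by move=> a; have [C C0 CP] := rec a; exists C.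
apply: rectifiableP; exists ((size net)%:R * D + \sum_(a <- c) C a) => s ss sI.
have nthI i : (i < size s)%N -> I s`_i by move=> /(mem_nth 0)/sI.
pose P a t := `[< cover a (g t) >].
have small a : \sum_(0 <= i < (size s).-1 | P a s`_i && P a s`_i.+1)
    mdist (g s`_i) (g s`_i.+1) <= C a.
  apply: le_trans (chain_length_filter (P a) s) _; apply: (CP a).2.
  - by apply: sorted_filter => //; exact: lt_trans.
  - by move=> t /=; rewrite mem_filter => /andP[_ /sI].
  - by move=> t; rewrite mem_filter => /andP[/asboolP].
have big := big_jumps net d s netP ss sI.
apply: le_trans (lerD big (ler_sum _ (fun a _ => small a))).
under [X in _ + X]eq_bigr do rewrite big_mkcond.
rewrite exchange_big /= [X in X + _]big_mkcond -big_split /= /chain_length.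
apply: ler_sum_nat => i /andP[_ lti].
have sum0 : 0 <= \sum_(a <- c)
    (if P a s`_i && P a s`_i.+1 then mdist (g s`_i) (g s`_i.+1) else 0).
  by apply: sumr_ge0 => a _; case: ifP => // _; exact: mdist_ge0.
have [le_d|lt_d] := leP d (mdist (g s`_i) (g s`_i.+1)); first by rewrite lerDl.
rewrite add0r; have [||a ac [ci ci1]] := coverP s`_i s`_i.+1 _ _ lt_d.
- by apply: nthI; lia.
- by apply: nthI; lia.
rewrite (big_rem a ac) /= /P !asboolT //= lerDl; apply: sumr_ge0 => b _.
by case: ifP => // _; exact: mdist_ge0.
Qed.

End Chains.

(** * From local to global by compactness *)

Theorem mainTheorem3 (R : realType) (X : metricType R)
  (Xcomplete : complete_space X) (Xlc : locally_compact [set: X])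
  (Xgeodesic : geodesic_space X) (XLEG : LEG X) (XLRB : LRB X)
  (I : set R) (Iitv : is_interval I) (g : R -> X)
  (gbounded : metric_bounded (g @` I)) (gsc : self_contracted I g) :
  rectifiable I g.
Proof.
have [[t0 It0]|noI] := pselect (exists t, I t); last first.
  apply: rectifiableP; exists 0 => -[|a s] _ sI.
    by rewrite /chain_length big_geq.
  by case: noI; exists a; apply: sI; rewrite /= mem_head.
have [D0 diam] := gbounded; pose D := Num.max 0 D0.
have D_ge0 : 0 <= D by rewrite le_max lexx.
have {}diam t u : I t -> I u -> mdist (g t) (g u) <= D.
  by move=> It Iu; rewrite le_max diam ?orbT.
have /choice[r rP] : forall x, exists r : R, 0 < r /\ rectifiable_within I g (ball x r).
  move=> x; have [e e0 leg] := XLEG x; have [H [K [H0 K0 lrb]]] := XLRB x.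
  have [r r0 [M [dir dirP]]] := local_direction_map x e H K Xlc Xgeodesic e0 leg H0 K0 lrb.
  exists r; split=> //.
  exact: direction_map_rectifiable_within I g gsc D diam _ M dir dirP.
pose A : set X := [set y | mdist (g t0) y <= D].
have IA t : I t -> A (g t) by exact: diam.
have tbA := closed_ball_totally_bounded (g t0) Xcomplete Xlc Xgeodesic D.
(* Only [u] is confined to [S]: were [v] confined too, a union would lose the pairs with one point
   in each set. *)
pose J (S : set X) := exists2 d : R, 0 < d & exists c : seq X, forall u v,
  S u -> mdist u v < d -> exists2 x, x \in c & ball x (r x) u /\ ball x (r x) v.
have [d d0 [c cP]] : J A.
  apply: compact_locally_ideal.
  - exact: totally_bounded_compact Xcomplete (closed_mdist_le _ _) tbA.
  - by exists 1 => //; exists [::].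
  - by move=> S S' SS' [d d0 [c cP]]; exists d => //; exists c => u v /SS'; exact: cP.
  - move=> S S' [d d0 [c cP]] [d' d'0 [c' cP']]; exists (Num.min d d').
      by rewrite lt_min d0.
    exists (c ++ c') => u v Suv; rewrite lt_min => /andP[uv uv'].
    by case: Suv => [/cP/(_ uv)|/cP'/(_ uv')] [x xc ?]; exists x => //;
      rewrite mem_cat xc ?orbT.
  - move=> x _; have [r0 _] := rP x; have r2 : 0 < r x / 2 by lra.
    exists (ball x (r x / 2)); first exact: nbhsx_ballx.
    exists (r x / 2) => //; exists [:: x] => u v /ball_mdist xu uv.
    exists x; first by rewrite inE.
    split; apply/ball_mdist; first by lra.
    by have := metric_triangle x u v; lra.
have d2 : 0 < d / 2 by lra.
have [net netP] := tbA _ d2.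
apply: (rectifiable_of_local I g gsc D D_ge0 diam net X (fun x => ball x (r x)) c d).
- by move=> t /IA/netP.
- by move=> x; have [] := rP x.
- by move=> t u It _; apply: cP; exact: IA.
Qed.
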